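(* Fix an integer $k\ge3$. For all integers $b,N\ge1$ and every real $\varepsilon>0$, there is a $2$-connected graph $G$ such that $$\chi(G)=k+1,\qquad \omega(G)=k,\qquad |E(G)|\le k|V(G)|,$$ $$\tau_k(G)=N,\qquad \nu_k^{1/c}(G)=c\quad\text{for every integer }c\text{ with }1\le c\le b,$$ and moreover $1<\nu_k^*(G)<1+\varepsilon$ if $N\ge2$, while $\nu_k^*(G)=1$ if $N=1$.
   Context: All graphs are finite and simple. $\chi$ denotes chromatic number and $\omega$ clique number. An odd cycle $C$ of a graph $G$ (a cycle subgraph of odd length, not necessarily induced) is called $k$-bad if $\chi(G[V(C)])\ge k+1$, where $G[V(C)]$ is the subgraph of $G$ induced by $V(C)$. $\mathcal C_k(G)$ denotes the family of $k$-bad odd cycles of $G$. - $\tau_k(G)$ is the minimum size of a set $X\subseteq V(G)$ meeting $V(C)$ for every $C\in\mathcal C_k(G)$. - For an integer $b\ge1$, $\nu_k^{1/b}(G)$ is the maximum cardinality of a set of distinct cycles from $\mathcal C_k(G)$ such that every vertex of $G$ lies in at most $b$ of them. - $\nu_k^*(G)$ is the fractional packing number of the hypergraph with edges $\mathcal F=\{V(C):C\in\mathcal C_k(G)\}$ on $V(G)$, i.e. the maximum of $\sum_{F\in\mathcal F}y_F$ over real $y_F\ge0$ with $\sum_{F\ni v}y_F\le1$ for every $v\in V(G)$. *)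

(* Defs.v *)
From mathcomp Require Import all_boot all_order all_algebra.

Set Implicit Arguments.
Unset Strict Implicit.
Unset Printing Implicit Defensive.

Import Order.TTheory GRing.Theory Num.Theory.

Record sgraph := SGraph {
  vertex :> finType;
  adj : rel vertex;
  adj_sym : symmetric adj;
  adj_irrefl : irreflexive adj }.

Section Graphs.
Local Open Scope nat_scope.

Definition edges (G : sgraph) : {set {set G}} :=
  [set [set p.1; p.2] | p : G * G & adj p.1 p.2].

Section Induced.
Variables (G : sgraph) (A : {set G}).

Definition induced_adj : rel {x : G | x \in A} :=
  fun x y => adj (val x) (val y).

Lemma induced_adj_sym : symmetric induced_adj.
Proof. by move=> x y; exact: adj_sym. Qed.

Lemma induced_adj_irrefl : irreflexive induced_adj.
Proof. by move=> x; exact: adj_irrefl. Qed.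

Definition induced : sgraph := SGraph induced_adj_sym induced_adj_irrefl.

End Induced.

Definition colorable (G : sgraph) (n : nat) : bool :=
  [exists f : {ffun G -> 'I_n}, [forall x, forall y, adj x y ==> (f x != f y)]].

Lemma colorable_card (G : sgraph) : exists n, colorable G n.
Proof.
exists #|G|; apply/existsP; exists [ffun x => enum_rank x].
apply/forallP => x; apply/forallP => y; apply/implyP => xy; rewrite !ffunE.
by apply: contraL xy => /eqP/enum_rank_inj ->; rewrite adj_irrefl.
Qed.

Definition chromatic_number (G : sgraph) : nat := ex_minn (colorable_card G).

Definition is_clique (G : sgraph) (K : {set G}) : bool :=
  [forall x in K, forall y in K, (x != y) ==> adj x y].

Definition clique_number (G : sgraph) : nat :=
  \max_(K : {set G} | is_clique K) #|K|.

Definition is_connected (G : sgraph) : bool :=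
  (0 < #|G|) && [forall x : G, forall y : G, connect (@adj G) x y].

Definition k_connected (k : nat) (G : sgraph) : bool :=
  (k < #|G|) &&
  [forall X : {set G}, (#|X| < k) ==> is_connected (induced (~: X))].

Definition cycle_edges (G : sgraph) (c : seq G) : {set {set G}} :=
  [set [set x; next c x] | x in c].

(* A cycle subgraph has no isolated vertex, so it is represented by its edge
   set C alone: its vertex set is cover C and its length is #|C|. In particular
   two cycles on the same vertices with different edges are distinct.
   A duplicate-free sequence of vertices has at most #|G| terms, so the bound
   on n excludes nothing. *)
Definition is_cycle (G : sgraph) (C : {set {set G}}) : bool :=
  [exists n : 'I_#|G|.+1, exists c : n.-tuple G,
     [&& 2 < n, uniq c, cycle (@adj G) c & C == cycle_edges c]].

Definition bad_cycles (G : sgraph) (k : nat) : {set {set {set G}}} :=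
  [set C | [&& is_cycle C, odd #|C| &
               k.+1 <= chromatic_number (induced (cover C))]].

Definition hits_bad_cycles (G : sgraph) (k : nat) (X : {set G}) : bool :=
  [forall C in bad_cycles G k, ~~ [disjoint X & cover C]].

Lemma card_cycle_edges (G : sgraph) (c : seq G) :
  uniq c -> 2 < size c -> #|cycle_edges c| = size c.
Proof.
move=> Uc c2; rewrite /cycle_edges card_in_imset; first by rewrite (card_uniqP Uc).
have next_neq x : x \in c -> next c (next c x) != x.
  move=> xc; have [i s ci] := rot_to xc.
  rewrite -!(next_rot i Uc) ci /=; move: c2 (Uc); rewrite -(size_rot i) -(rot_uniq i) ci.
  case: s {ci} => [|y [|z s]] //= _ /andP[]; rewrite !inE !negb_or.
  move=> /and3P[/negbTE xy xz _] _.
  have -> : (x == x) = true by rewrite eqxx.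
  have -> : (y == x) = false by rewrite eq_sym.
  by rewrite eqxx eq_sym.
move=> x y xc yc /setP E.
have := E x; have := E (next c x); rewrite !inE !eqxx orbT /=.
move=> /esym nxy /esym; case: (eqVneq x y) => //= xy /eqP xny.
case/orP: nxy => /eqP nx.
  by have := next_neq y yc; rewrite -xny nx eqxx.
by have := next_neq x xc; rewrite nx -xny nx -xny eqxx.
Qed.

Lemma cycle_edges_cover (G : sgraph) (c : seq G) (x : G) :
  x \in c -> x \in cover (cycle_edges c).
Proof.
move=> xc; apply/bigcupP; exists [set x; next c x]; last exact: set21.
exact: imset_f.
Qed.

Lemma bad_cycle_neq0 (G : sgraph) (k : nat) (C : {set {set G}}) :
  C \in bad_cycles G k -> cover C != set0.
Proof.
rewrite inE => /and3P[/existsP[n /existsP[c /and4P[n2 _ _ /eqP->]]] _ _].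
have : 0 < size c by rewrite size_tuple; apply: leq_trans n2.
case: (tval c) => // x s _; apply/set0Pn; exists x.
by apply: cycle_edges_cover; rewrite mem_head.
Qed.

Lemma hits_bad_cyclesT (G : sgraph) (k : nat) : hits_bad_cycles k [set: G].
Proof.
apply/forallP => C; apply/implyP => /bad_cycle_neq0/set0Pn[x xC].
by apply/pred0Pn; exists x; rewrite /= in_setT.
Qed.

Definition tau (G : sgraph) (k : nat) : nat :=
  #|[arg min_(X < [set: G] | hits_bad_cycles k X) #|X|]|.

Definition is_bpacking (G : sgraph) (k b : nat) (P : {set {set {set G}}}) :
    bool :=
  (P \subset bad_cycles G k) &&
  [forall v : G, #|[set C in P | v \in cover C]| <= b].

(* Usually written nu_k^{1/b}(G). *)
Definition nu (G : sgraph) (k b : nat) : nat :=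
  \max_(P : {set {set {set G}}} | is_bpacking k b P) #|P|.

Definition bad_hypergraph (G : sgraph) (k : nat) : {set {set G}} :=
  [set cover C | C in bad_cycles G k].

End Graphs.

From mathcomp Require Import all_classical all_reals all_analysis.
Import numFieldNormedType.Exports.

Section FractionalPacking.
Local Open Scope ring_scope.
Variables (R : realType) (V : finType) (H : {set {set V}}).

Definition fractional_packing (y : {set V} -> R) : Prop :=
  (forall F, F \in H -> 0 <= y F) /\
  (forall v : V, \sum_(F in H | v \in F) y F <= 1).

Definition packing_value (y : {set V} -> R) : R := \sum_(F in H) y F.

(* This supremum is a maximum when no edge is empty (fractional_packing_max),
   in particular for the hypergraphs of bad cycles (nu_star_max). *)
Definition fractional_packing_number : R :=
  sup [set packing_value y | y in fractional_packing]%classic.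

Lemma fractional_packing_le1 (y : {set V} -> R) (F : {set V}) :
  fractional_packing y -> F \in H -> F != finset.set0 -> y F <= 1.
Proof.
move=> [y0 y1] FH /finset.set0Pn[v vF]; apply: le_trans (y1 v).
rewrite (bigD1 F) ?FH//= lerDl sumr_ge0// => F' /andP[/andP[F'H _] _].
exact: y0.
Qed.

Lemma fractional_packing_max : finset.set0 \notin H ->
  exists2 y, fractional_packing y &
    packing_value y = fractional_packing_number /\
    forall z, fractional_packing z -> packing_value z <= packing_value y.
Proof.
move=> H0.
have Hneq0 F : F \in H -> F != finset.set0.
  by apply: contraTneq => ->.
pose f (u : 'rV[R]_#|{set V}|) (F : {set V}) : R := u ord0 (enum_rank F).
have fcont (P : pred {set V}) :
    continuous (fun u : 'rV[R]_#|{set V}| => \sum_(F | P F) f u F).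
  apply: continuous_big; first exact: add_continuous.
  by move=> F _; exact: coord_continuous.
pose cube := [set u : 'rV[R]_#|{set V}| |
  forall i, `[0 : R, 1]%classic (u ord0 i)]%classic.
pose cap v := [set u : 'rV[R]_#|{set V}| |
  \sum_(F in H | v \in F) f u F <= 1]%classic.
pose K := (cube `&` \bigcap_(v in [set: V]) cap v)%classic.
have cK : compact K.
  apply: compact_closedI.
    by apply: (@rV_compact R _ (fun=> `[0, 1]%classic)) => i; exact: segment_compact.
  apply: closed_bigI => v _.
  apply: (@preimage_closed _ _ _ [set x : R | x <= 1]%classic).
    by move=> u _; exact: fcont.
  exact: closed_le.
have KP u : K u -> fractional_packing (f u).
  move=> [u01 u1]; split=> [F _|v]; last exact: u1.
  by have := u01 (enum_rank F); rewrite /= in_itv /= => /andP[].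
have PK z : fractional_packing z ->
    exists2 u, K u & packing_value (f u) = packing_value z.
  move=> pz; exists (\row_i (if enum_val i \in H then z (enum_val i) else 0)).
    split=> [i|v _] /=.
      rewrite mxE in_itv /=; case: ifPn => [iH|_]; last by rewrite lexx ler01.
      by rewrite pz.1//= fractional_packing_le1// Hneq0.
    rewrite /cap /=; apply: le_trans (pz.2 v); apply: ler_sum => F /andP[FH _].
    by rewrite /f mxE enum_rankK FH.
  by apply: eq_bigr => F FH; rewrite /f mxE enum_rankK FH.
have zero : fractional_packing (fun=> 0).
  by split=> // v; rewrite big1// ler01.
have [u0 Ku0 _] := PK _ zero.
have [||u uK umax] := @compact_EVT_max _ R (fun u => packing_value (f u)) K _ cK.
- by exists u0.
- by apply: continuous_subspaceT; exact: fcont.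
have ymax z : fractional_packing z -> packing_value z <= packing_value (f u).
  by move=> /PK[w Kw <-]; apply: umax; rewrite inE.
have pu : fractional_packing (f u) by apply: KP; move: uK; rewrite inE.
exists (f u) => //; split=> //; apply/le_anti/andP; split.
  apply: ub_le_sup; last by exists (f u).
  by exists (packing_value (f u)) => _ [z pz <-]; exact: ymax.
apply: ge_sup; first by exists (packing_value (f u)), (f u).
by move=> _ [z pz <-]; exact: ymax.
Qed.

End FractionalPacking.

Definition nu_star (R : realType) (G : sgraph) (k : nat) : R :=
  fractional_packing_number R (bad_hypergraph G k).

Lemma nu_star_max (R : realType) (G : sgraph) (k : nat) :
  exists2 y : {set G} -> R, fractional_packing (bad_hypergraph G k) y &
    packing_value (bad_hypergraph G k) y = nu_star R G k /\
    forall z, fractional_packing (bad_hypergraph G k) z ->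
      (packing_value (bad_hypergraph G k) z <=
       packing_value (bad_hypergraph G k) y)%R.
Proof.
apply: fractional_packing_max; apply/imsetP => -[C /bad_cycle_neq0 + C0].
by rewrite -C0 eqxx.
Qed.

(* Main.v *)
Require Import Defs.
From mathcomp Require Import all_boot all_order all_algebra reals.
From mathcomp Require Import zify.

Set Implicit Arguments.
Unset Strict Implicit.
Unset Printing Implicit Defensive.

Import Order.TTheory GRing.Theory Num.Theory.

(** Since k >= 3, a vertex of degree 2 never obstructs a k-colouring.  So take
    any graph H and join every two of its vertices by many paths of length 2
    ([link]).  The k-colourability of an induced subgraph of the result is
    decided by its trace W on H ([link_colorable_on]), while as soon as H[W] is
    not k-colourable there is an odd cycle whose trace is exactly W: start
    from an edge of H[W] and go through all of W along new paths, which gives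
    odd length because the edge is the only piece of length 1
    ([link_bad_cycle]).  The traces of bad cycles are therefore exactly the
    sets W such that H[W] is not k-colourable.  Moreover the new paths give
    2-connectedness, the edge bound (each new vertex carries at most three
    edges, counting the edge of H between its two neighbours) and several bad
    cycles with the same trace.

    It remains to find H with an independent set S of m = N + l vertices,
    l large, such that every W missing at least N vertices of S is
    k-colourable, although no deletion of fewer than N vertices makes H
    k-colourable.  Every bad cycle then misses at most N - 1 of the vertices
    of S.  Hence N of them meet all bad cycles, so tau = N, and counting
    incidences with S in a packing gives nu^{1/c} <= c m / (l + 1) < c + 1 as
    well as nu^* <= m / (l + 1) < 1 + eps.  If N >= 2 then each vertex v is
    avoided by some bad cycle F_v, and the weights 1 / (n - 1) on the F_v, with
    n the number of vertices, form a fractional packing of value > 1.  Both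
    numbers chi = k + 1 and omega = k also follow from these properties: a
    clique meets S at most once, so it is k-colourable.

    To build H, start from a chain of m cliques K_(k-1), the i-th one joined
    to two vertices z_i and z_(i+1), with an edge from z_0 to z_m ([chain]).
    A k-colouring would give all z_i the same colour, hence there is none; but
    if a vertex x_i of the i-th clique is missing, then a k-colouring exists in
    which all other x_j have colour 0.  Now take one copy of the chain for
    each set D of fewer than N positions and each j < N, and identify all
    copies of x_i over the D that do not contain i ([glue]); S consists of the
    vertices so obtained.  When N of them are missing, every copy lacks an
    identified x_i and can be coloured separately, all of S receiving
    colour 0.  When fewer than N vertices X are deleted, let D be the set of
    positions of X in S: one of the N copies indexed by D is intact. *)

(** * Colourings of vertex subsets *)

Definition colorable_on (G : sgraph) (A : {set G}) (k : nat) : Prop :=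
  exists2 f : G -> nat, {in A, forall x, f x < k} &
    {in A &, forall x y, adj x y -> f x != f y}.

Lemma colorable_onS (G : sgraph) (A B : {set G}) k :
  A \subset B -> colorable_on B k -> colorable_on A k.
Proof.
move=> /subsetP sAB [f fk fP]; exists f => [x /sAB/fk //|x y /sAB xB /sAB yB].
exact: fP.
Qed.

Lemma colorableP (G : sgraph) k :
  colorable G k <-> exists2 f : G -> nat, forall x, f x < k &
    forall x y, adj x y -> f x != f y.
Proof.
split=> [/existsP[f /forallP fP]|[f fk fP]].
  exists (fun x => f x : nat) => [x|x y xy]; first exact: ltn_ord.
  by have /forallP/(_ y)/implyP/(_ xy) := fP x.
apply/existsP; exists [ffun x => Ordinal (fk x)].
by apply/forallP => x; apply/forallP => y; apply/implyP => /fP; rewrite !ffunE.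
Qed.

Lemma colorable_inducedP (G : sgraph) (A : {set G}) k :
  colorable (induced A) k <-> colorable_on A k.
Proof.
split=> [/colorableP[f fk fP]|[f fk fP]].
  pose g (x : G) : nat := if insub x is Some u then f u else 0.
  have gE x (xA : x \in A) : g x = f (exist _ x xA) by rewrite /g insubT.
  exists g => [x xA|x y xA yA xy]; first by rewrite gE.
  by rewrite !gE fP.
apply/colorableP; exists (fun x => f (val x)) => [x|x y xy].
  exact: fk (valP x).
by apply: fP xy; apply: valP.
Qed.

(** Colourability is monotone in the number of colours, so the minimum in the
    definition decides it for every k. *)
Lemma chromatic_number_le (G : sgraph) k :
  (chromatic_number G <= k) = colorable G k.
Proof.
rewrite /chromatic_number; case: ex_minnP => n nG nmin.
apply/idP/idP => [nk|/nmin //]; apply/colorableP.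
have /colorableP[f fn fP] := nG.
by exists f => // x; apply: leq_trans (fn x) nk.
Qed.

Lemma colorable_setT (G : sgraph) k : colorable G k <-> colorable_on [set: G] k.
Proof.
split=> [/colorableP[f fk fP]|[f fk fP]].
  by exists f => [x _|x y _ _]; [exact: fk|exact: fP].
by apply/colorableP; exists f => [x|x y]; [apply: fk|apply: fP]; rewrite in_setT.
Qed.

Lemma clique_colorable_on (G : sgraph) (K : {set G}) k :
  is_clique K -> colorable_on K k -> #|K| <= k.
Proof.
move=> /forallP cK [f fk fP]; rewrite cardE -(size_map f) -(size_iota 0 k).
apply: uniq_leq_size => [|c /mapP[x]]; last first.
  by rewrite mem_enum mem_iota => /fk ? ->.
rewrite map_inj_in_uniq ?enum_uniq// => x y; rewrite !mem_enum => xK yK fxy.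
apply/eqP/negPn/negP => nxy.
have /implyP/(_ xK)/forallP/(_ y)/implyP/(_ yK)/implyP/(_ nxy) xy := cK x.
by have := fP x y xK yK xy; rewrite fxy eqxx.
Qed.

Lemma colorable_onU_indep (G : sgraph) (A S : {set G}) k :
  colorable_on A k -> {in S &, forall x y, ~~ adj x y} ->
  colorable_on (A :|: S) k.+1.
Proof.
move=> [f fk fP] Sind; exists (fun x => if x \in S then k else f x).
  by move=> x; rewrite inE; case: ifP => //= _; rewrite orbF => /fk/ltnW.
move=> x y; rewrite !inE.
case: ifP => xS; case: ifP => yS; rewrite /= ?orbF => xA yA xy.
- by have := Sind x y xS yS; rewrite xy.
- by rewrite gtn_eqF ?fk.
- by rewrite ltn_eqF ?fk.
- exact: fP.
Qed.

(** * Bad cycles *)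

Lemma mem_cover_cycle_edges (G : sgraph) (c : seq G) x :
  (x \in cover (cycle_edges c)) = (x \in c).
Proof.
apply/idP/idP => [|/cycle_edges_cover//].
case/bigcupP => _ /imsetP[y yc ->]; rewrite !inE => /orP[]/eqP-> //.
by rewrite mem_next.
Qed.

Lemma bad_cycle_not_colorable (G : sgraph) k (C : {set {set G}}) :
  C \in bad_cycles G k -> ~ colorable_on (cover C) k.
Proof.
rewrite inE => /and3P[_ _]; rewrite ltnNge chromatic_number_le => /negP + cC.
by apply; apply/colorable_inducedP.
Qed.

Lemma bad_cycle_of_seq (G : sgraph) k (c : seq G) :
  2 < size c -> odd (size c) -> uniq c -> cycle (@adj G) c ->
  ~ colorable_on [set x in c] k -> cycle_edges c \in bad_cycles G k.
Proof.
move=> c2 codd Uc cc nc; rewrite inE card_cycle_edges// codd /=; apply/andP; split.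
  have cG : size c < #|G|.+1 by rewrite ltnS -(card_uniqP Uc) max_card.
  apply/existsP; exists (Ordinal cG); apply/existsP; exists (in_tuple c).
  exact/and4P.
rewrite ltnNge chromatic_number_le; apply/negP => /colorable_inducedP cC.
apply/nc/(colorable_onS _ cC)/subsetP => x.
by rewrite inE mem_cover_cycle_edges.
Qed.

(** * Linking all vertices by paths of length two *)

(** A colour among 0, 1, 2 that differs from two given ones. *)
Definition third_color (a b : nat) : nat :=
  if (a != 0) && (b != 0) then 0 else if (a != 1) && (b != 1) then 1 else 2.

Lemma third_colorP a b :
  [/\ third_color a b < 3, third_color a b != a & third_color a b != b].
Proof. by rewrite /third_color; case: a b => [|[|a]] [|[|b]]. Qed.

(** The graph H, where for each ordered pair of distinct vertices M new
    vertices are attached to both.  The index j in 'I_M labels M disjoint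
    systems of connecting paths. *)
Section Link.
Variables (H : sgraph) (M : nat).

Definition link_pair := {p : H * H | p.1 != p.2}.
Definition link_vertex := (H + 'I_M * link_pair)%type.

Definition link_adj (x y : link_vertex) : bool :=
  match x, y with
  | inl u, inl v => adj u v
  | inl u, inr w | inr w, inl u => (u == (val w.2).1) || (u == (val w.2).2)
  | inr _, inr _ => false
  end.

Lemma link_adj_sym : symmetric link_adj.
Proof. by case=> [u|w] [v|w'] //=; rewrite adj_sym. Qed.

Lemma link_adj_irrefl : irreflexive link_adj.
Proof. by case=> [u|w] //=; rewrite adj_irrefl. Qed.

Definition link : sgraph := SGraph link_adj_sym link_adj_irrefl.

(** The new vertex of system j between u and v.  The value at u = v is
    arbitrary; totality spares [weave] below a proof that consecutive vertices
    are distinct. *)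
Definition mid (j : 'I_M) (u v : H) : link :=
  if insub (u, v) is Some p then inr (j, p) else inl u.

Lemma midE j u v (uv : u != v) : mid j u v = inr (j, exist _ (u, v) uv).
Proof. by rewrite /mid insubT. Qed.

Lemma adj_midl j u v : u != v -> adj (inl u : link) (mid j u v).
Proof. by move=> uv; rewrite (midE j uv) /= eqxx. Qed.

Lemma adj_midr j u v : u != v -> adj (mid j u v) (inl v : link).
Proof. by move=> uv; rewrite (midE j uv) /= eqxx orbT. Qed.

(** Each edge is charged to a new vertex: to the new endpoint if there is one,
    and otherwise to a new vertex between the two ends. *)
Lemma card_edges_link : 0 < M -> #|edges link| <= 3 * #|link|.
Proof.
move=> M0.
pose w := ('I_M * link_pair)%type.
pose f1 (z : w) : {set link} := [set inl (val z.2).1; inl (val z.2).2].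
pose f2 (z : w) : {set link} := [set inr z; inl (val z.2).1].
pose f3 (z : w) : {set link} := [set inr z; inl (val z.2).2].
have sub : edges link \subset f1 @: setT :|: (f2 @: setT :|: f3 @: setT).
  apply/subsetP => _ /imsetP[[x y] + ->]; rewrite !inE /=.
  case: x y => [u|z] [v|z'] //=.
  - move=> uv; have nuv : u != v by apply: contraTneq uv => ->; rewrite adj_irrefl.
    apply/orP; left; apply/imsetP.
    by exists (Ordinal M0, exist _ (u, v) nuv).
  - case/orP=> /eqP->; rewrite setUC; apply/orP; right; apply/orP.
      by left; apply/imsetP; exists z'.
    by right; apply/imsetP; exists z'.
  - case/orP=> /eqP->; apply/orP; right; apply/orP.
      by left; apply/imsetP; exists z.
    by right; apply/imsetP; exists z.
have wl : #|{: w}| <= #|link| by rewrite card_sum leq_addl.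
have fle (f : w -> {set link}) : #|f @: setT| <= #|link|.
  by apply: leq_trans (leq_imset_card _ _) _; rewrite cardsT.
apply: leq_trans (subset_leq_card sub) _.
apply: leq_trans (leq_card_setU _ _) _; rewrite mulSn leq_add//.
by apply: leq_trans (leq_card_setU _ _) _; rewrite mul2n -addnn leq_add.
Qed.

(** Two vertices of H have two common new neighbours, and a new vertex has two
    neighbours in H; a single deleted vertex destroys neither connection. *)
Lemma link_2connected : 1 < M -> 2 < #|H| -> k_connected 2 link.
Proof.
move=> M1 H2; apply/andP; split.
  by apply: leq_trans H2 _; rewrite card_sum leq_addr.
apply/forallP => X; apply/implyP => X2.
have X1 a b : a \in X -> b \in X -> a = b.
  move=> aX bX; apply/eqP; apply: contraLR X2 => ab.
  rewrite -leqNgt; have <- : #|[set a; b]| = 2 by rewrite cards2 ab.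
  by apply/subset_leq_card/subsetP => z; rewrite !inE => /orP[]/eqP->.
pose vtx (a : link) (aX : a \in ~: X) : induced (~: X) := exist _ a aX.
have vtx_adj a b aX bX : adj a b ->
    connect (@adj (induced (~: X))) (@vtx a aX) (@vtx b bX).
  by move=> ab; apply: connect1.
have csym : connect_sym (@adj (induced (~: X))).
  by apply: sym_connect_sym; apply: adj_sym.
(* Vertices of H outside X are joined through a new vertex outside X. *)
have HH u v uX vX : connect (@adj (induced (~: X))) (@vtx (inl u) uX) (@vtx (inl v) vX).
  have [uv|nuv] := eqVneq u v.
    by move: uX vX; rewrite uv => uX vX; rewrite (bool_irrelevance uX vX).
  have [j jX] : exists j, mid j u v \in ~: X.
    have [j0|] := boolP (mid (Ordinal (ltnW M1)) u v \in ~: X).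
      by exists (Ordinal (ltnW M1)).
    rewrite inE negbK => j0X; exists (Ordinal M1); rewrite inE; apply/negP => j1X.
    by have := X1 _ _ j0X j1X; rewrite !(midE _ nuv) => -[].
  apply: (@connect_trans _ _ (vtx _ jX)); apply: vtx_adj.
    exact: adj_midl.
  exact: adj_midr.
(* Every vertex outside X is equal or adjacent to a vertex of H outside X. *)
have toH a (aX : a \in ~: X) : exists u (uX : inl u \in ~: X),
    connect (@adj (induced (~: X))) (vtx _ aX) (@vtx (inl u) uX).
  case: a aX => [u|w] aX; first by exists u, aX.
  have e12 := valP w.2.
  have [e1X|] := boolP ((inl (val w.2).1 : link) \in ~: X).
    by exists (val w.2).1, e1X; apply: vtx_adj; rewrite /= eqxx.
  rewrite inE negbK => e1X.
  have e2X : (inl (val w.2).2 : link) \in ~: X.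
    rewrite inE; apply/negP => e2X; have := X1 _ _ e1X e2X => -[] e.
    by move: e12; rewrite e eqxx.
  by exists (val w.2).2, e2X; apply: vtx_adj; rewrite /= eqxx orbT.
apply/andP; split.
  have /set0Pn[a aX] : ~: X != set0.
    rewrite -card_gt0 cardsCs setCK subn_gt0 (leq_trans X2)// (leq_trans (ltnW H2))//.
    by rewrite card_sum leq_addr.
  by apply/card_gt0P; exists (vtx _ aX).
apply/forallP => -[a aX]; apply/forallP => -[b bX].
have [u [uX au]] := toH a aX; have [v [vX bv]] := toH b bX.
apply: connect_trans au _; apply: connect_trans (HH _ _ uX vX) _.
by rewrite csym.
Qed.

(** A new vertex has only two neighbours, both in H, so one of the colours 0, 1,
    2 is free for it. *)
Lemma link_colorable_on (A : {set link}) k :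
  2 < k -> colorable_on (inl @^-1: A : {set H}) k -> colorable_on A k.
Proof.
move=> k2 [f fk fP].
pose f' (x : link) : nat :=
  match x with
  | inl u => f u
  | inr w => third_color (f (val w.2).1) (f (val w.2).2)
  end.
exists f' => [[u|w] xA|[u|w] [v|w'] xA yA] //=.
- by apply: fk; rewrite inE.
- by have [lt3 _ _] := third_colorP (f (val w.2).1) (f (val w.2).2); apply: leq_trans k2.
- by apply: fP; rewrite inE.
- have [_ n1 n2] := third_colorP (f (val w'.2).1) (f (val w'.2).2).
  by case/orP=> /eqP->; rewrite eq_sym.
- have [_ n1 n2] := third_colorP (f (val w.2).1) (f (val w.2).2).
  by case/orP=> /eqP->.
Qed.

Lemma colorable_on_inl (A : {set link}) k :
  colorable_on A k -> colorable_on (inl @^-1: A : {set H}) k.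
Proof.
move=> [f fk fP]; exists (fun u => f (inl u)) => [u|u v]; rewrite !inE.
  exact: fk.
by move=> uA vA uv; apply: fP.
Qed.

(** The path through s from u, without its first vertex u, that makes each step
    along system j. *)
Fixpoint weave (j : 'I_M) (u : H) (s : seq H) : seq link :=
  if s is v :: s' then mid j u v :: inl v :: weave j v s' else [::].

Lemma size_weave j u s : size (weave j u s) = (size s).*2.
Proof. by elim: s u => //= v s IHs u; rewrite IHs. Qed.

Lemma last_weave j u s : last (inl u) (weave j u s) = inl (last u s) :> link.
Proof. by elim: s u => //= v s IHs u; rewrite IHs. Qed.

Lemma path_weave j u s :
  uniq (u :: s) -> path (@adj link) (inl u) (weave j u s).
Proof.
elim: s u => //= v s IHs u; rewrite inE negb_or => /andP[/andP[uv _]] Us.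
by apply/and3P; split; [exact: adj_midl|exact: adj_midr|exact: IHs].
Qed.

Lemma inl_weave j u s v :
  uniq (u :: s) -> ((inl v : link) \in weave j u s) = (v \in s).
Proof.
elim: s u => //= v' s IHs u; rewrite inE negb_or => /andP[/andP[uv _]] Us.
by rewrite (midE j uv) !inE (IHs v').
Qed.

(** The new vertices of the path are told apart by their second ends, the
    successive vertices of s; this makes the path duplicate-free. *)
Lemma inr_weave j u s w :
  uniq (u :: s) -> (inr w : link) \in weave j u s ->
  w.1 = j /\ (val w.2).2 \in s.
Proof.
elim: s u => //= v s IHs u; rewrite inE negb_or => /andP[/andP[uv _]] Us.
rewrite (midE j uv) !inE; case/orP=> [/eqP[->]|/orP[//|/(IHs _ Us)[-> ws]]].
  by rewrite eqxx.
by rewrite ws orbT.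
Qed.

Lemma uniq_weave j u s : uniq (u :: s) -> uniq (inl u :: weave j u s : seq link).
Proof.
elim: s u => // v s IHs u Us.
have := Us; rewrite cons_uniq [_ \in _]inE negb_or => /andP[/andP[uv us] Uvs].
rewrite cons_uniq inl_weave// inE negb_or uv us /=.
have /= -> := IHs _ Uvs; rewrite andbT (midE j uv) inE /=.
apply/negP => /(inr_weave Uvs)[_] /=.
by move: Uvs; rewrite /= => /andP[/negP].
Qed.

(** All non-k-colourable sets W of H are traces of bad cycles, with the free
    choice of a system j.  The last clause ensures that different systems give
    different cycles. *)
Lemma link_bad_cycle (W : {set H}) k (j : 'I_M) :
    0 < k -> ~ colorable_on W k ->
  exists C, [/\ C \in bad_cycles link k,
    forall u, ((inl u : link) \in cover C) = (u \in W),
    forall w, (inr w : link) \in cover C -> w.1 = j &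
    exists w, (inr w : link) \in cover C].
Proof.
move=> k0 nW.
have [a aW [b bW ab]] : exists2 a, a \in W & exists2 b, b \in W & adj a b.
  have [/existsP[a /existsP[b /and3P[aW bW ab]]]|/existsPn noedge] :=
    boolP [exists a, exists b, [&& a \in W, b \in W & adj a b]].
    by exists a => //; exists b.
  case: nW; exists (fun=> 0) => // x y xW yW xy; exfalso.
  by have /existsPn/(_ y) := noedge x; rewrite xW yW xy.
have nab : a != b by apply: contraTneq ab => ->; rewrite adj_irrefl.
(* W is listed from b to a, so that the edge ab closes the cycle. *)
pose s := rcons (enum (W :\ a :\ b)) a.
have Us : uniq (b :: s).
  rewrite /= mem_rcons rcons_uniq enum_uniq !inE !mem_enum !inE !eqxx /=.
  by rewrite orbF andbF eq_sym nab.
have memW u : (u \in b :: s) = (u \in W).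
  rewrite inE mem_rcons inE mem_enum !inE.
  by case: eqVneq => [->|_] //=; case: eqVneq => [->|].
pose c : seq link := inl b :: weave j b s.
have Uc : uniq c by exact: uniq_weave.
have inlc u : ((inl u : link) \in c) = (u \in W).
  by rewrite -memW /c !inE inl_weave.
have cc : cycle (@adj link) c.
  rewrite /c /= rcons_path path_weave//= last_weave /s last_rcons /=.
  exact: ab.
exists (cycle_edges c); split.
- apply: bad_cycle_of_seq => //.
  + by rewrite /= size_weave size_rcons.
  + by rewrite /= size_weave odd_double.
  + move=> /colorable_on_inl cW; apply/nW/(colorable_onS _ cW)/subsetP => u uW.
    by rewrite !inE -[_ || _]/((inl u : link) \in c) inlc.
- by move=> u; rewrite mem_cover_cycle_edges inlc.
- move=> w; rewrite mem_cover_cycle_edges inE /=.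
  by case/(inr_weave Us).
- have : 0 < size s by rewrite size_rcons.
  case sE: s => [//|v s'] _.
  have := Us; rewrite sE /= inE negb_or => /andP[/andP[bv _] _].
  exists (j, exist _ (b, v) bv); apply: (@cycle_edges_cover link).
  by rewrite /c sE /= -midE !inE eqxx orbT.
Qed.

End Link.

(** * Gluing copies of a graph along its ports *)

(** The M classes of a partial classification are disjoint, so fewer than M
    elements leave one class untouched.  It is used to find an intact copy of
    a chain, or an intact system of connecting paths. *)
Lemma avoid_class (T : finType) (M : nat) (X : {set T}) (c : T -> option 'I_M) :
  #|X| < M -> exists j, {in X, forall x, c x != Some j}.
Proof.
move=> XM; have [/existsP[j /forallP jP]|/existsPn noj] :=
  boolP [exists j, forall x, (x \in X) ==> (c x != Some j)].
  by exists j => x xX; have /implyP := jP x; apply.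
have Some_inj' : injective (@Some 'I_M) by move=> i j [].
have : M <= #|c @: X|.
  rewrite -[M in M <= _]card_ord -cardsT -(card_imset _ Some_inj').
  apply/subset_leq_card/subsetP => _ /imsetP[j _ ->].
  have := noj j; rewrite negb_forall => /existsP[x].
  rewrite negb_imply negbK => /andP[xX /eqP cx].
  by apply/imsetP; exists x.
by rewrite leqNgt (leq_ltn_trans (leq_imset_card _ _) XM).
Qed.

(** Copies of L are indexed by a set D of ports and a number j < N.  The port i
    of every copy with i outside D is replaced by one shared vertex inl i;
    ports in D stay private to their copy. *)
Section Glue.
Variables (L : sgraph) (m N : nat) (q : 'I_m -> L).
Hypothesis q_inj : injective q.

Definition glue_index := ({set 'I_m} * 'I_N)%type.
Definition glue_vertex := ('I_m + glue_index * L)%type.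

(** The embedding of the copy p of L in the glued graph. *)
Definition place (p : glue_index) (x : L) : glue_vertex :=
  if [pick i | (q i == x) && (i \notin p.1)] is Some i then inl i else inr (p, x).

Variant place_spec (p : glue_index) (x : L) : glue_vertex -> Type :=
| PlaceShared i of x = q i & i \notin p.1 : place_spec p x (inl i)
| PlacePrivate of (forall i, x = q i -> i \in p.1) : place_spec p x (inr (p, x)).

Lemma placeP p x : place_spec p x (place p x).
Proof.
rewrite /place; case: pickP => [i /andP[/eqP<- ip]|no]; first exact: PlaceShared.
apply: PlacePrivate => i xq; have := no i; rewrite xq eqxx /=.
by move=> /negbFE.
Qed.

Lemma place_inj p : injective (place p).
Proof.
move=> x y; case: placeP => [i -> _|_]; case: placeP => [j -> _|_] //.
  by case=> ->.
by case.
Qed.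

(** Only copies with #|D| < N carry edges, because [glue_colorable] needs each
    copy to lose a shared port when N shared vertices are missing. *)
Definition glue_adj (u v : glue_vertex) : bool :=
  [exists p : glue_index, (#|p.1| < N) &&
    [exists x, exists y, [&& adj x y, place p x == u & place p y == v]]].

Lemma glue_adjP u v : reflect
  (exists (p : glue_index) (x y : L),
    [/\ #|p.1| < N, adj x y, u = place p x & v = place p y])
  (glue_adj u v).
Proof.
apply: (iffP existsP) => [[p /andP[pN /existsP[x /existsP[y]]]]|].
  by move=> /and3P[xy /eqP<- /eqP<-]; exists p, x, y.
move=> [p [x [y [pN xy -> ->]]]]; exists p; rewrite pN /=.
by apply/existsP; exists x; apply/existsP; exists y; rewrite xy !eqxx.
Qed.

Lemma glue_adj_sym : symmetric glue_adj.
Proof.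
move=> u v; apply/glue_adjP/glue_adjP => -[p [x [y [pN xy uE vE]]]];
  by exists p, y, x; rewrite adj_sym.
Qed.

Lemma glue_adj_irrefl : irreflexive glue_adj.
Proof.
move=> u; apply/glue_adjP => -[p [x [y [_ xy -> /place_inj xyE]]]].
by rewrite xyE adj_irrefl in xy.
Qed.

Definition glue : sgraph := SGraph glue_adj_sym glue_adj_irrefl.

Definition shared : {set glue} := [set inl i | i in 'I_m].

Lemma card_shared : #|shared| = m.
Proof. by rewrite card_imset ?card_ord// => i j []. Qed.

Lemma shared_indep :
  (forall i j, ~~ adj (q i) (q j)) -> {in shared &, forall u v, ~~ adj u v}.
Proof.
move=> qq _ _ /imsetP[i _ ->] /imsetP[j _ ->]; apply/glue_adjP.
move=> [p [x [y [_ xy]]]]; case: placeP => // i' xE _ _; case: placeP => // j' yE _ _.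
by move: xy; rewrite xE yE (negbTE (qq _ _)).
Qed.

Lemma glue_clique (K : {set L}) :
  0 < N -> is_clique K -> exists2 K' : {set glue}, is_clique K' & #|K'| = #|K|.
Proof.
move=> N0 /forallP cK; pose p : glue_index := (set0, Ordinal N0).
exists (place p @: K); last exact/card_imset/place_inj.
apply/forallP => u; apply/implyP => /imsetP[x xK ->].
apply/forallP => v; apply/implyP => /imsetP[y yK ->].
apply/implyP => nxy; apply/glue_adjP; exists p, x, y; split=> //.
  by rewrite cards0.
have /implyP/(_ xK)/forallP/(_ y)/implyP/(_ yK)/implyP := cK x; apply.
by apply: contra_neq nxy => ->.
Qed.

(** If X has fewer than N vertices, let D be the set of ports whose shared
    vertex is in X.  The N copies with this D have disjoint private parts, so
    one of them avoids X altogether and is an intact copy of L. *)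
Lemma glue_not_colorable k (X : {set glue}) :
  ~ colorable L k -> #|X| < N -> ~ colorable_on (~: X) k.
Proof.
move=> nL XN [f fk fP].
pose D := [set i : 'I_m | (inl i : glue) \in X].
have DN : #|D| < N.
  apply: leq_ltn_trans XN.
  rewrite -(card_imset D (fun i j => @inl_inj _ (glue_index * L) i j)).
  by apply/subset_leq_card/subsetP => _ /imsetP[i + ->]; rewrite inE.
have [j jP] := avoid_class
  (fun u : glue => if u is inr (p, _) then Some p.2 else None) XN.
pose p : glue_index := (D, j).
have pX x : (place p x : glue) \in ~: X.
  rewrite inE; case: placeP => [i _|_]; first by rewrite inE.
  by apply/negP => /jP; rewrite eqxx.
apply/nL/colorableP; exists (fun x => f (place p x)) => [x|x y xy].
  exact/fk/pX.
by apply: fP; [exact: pX|exact: pX|apply/glue_adjP; exists p, x, y].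
Qed.

(** Every copy misses a shared port i outside its set D, since D has fewer than
    N elements, and can be coloured by g i.  These colourings agree on the
    shared vertices because they all give colour 0 to the remaining ports. *)
Lemma glue_colorable k (W : {set glue}) (g : 'I_m -> L -> nat) :
    0 < k ->
    (forall i x, g i x < k) -> (forall i j, j != i -> g i (q j) = 0) ->
    (forall i x y, x != q i -> y != q i -> adj x y -> g i x != g i y) ->
  N <= #|shared :\: W| -> colorable_on W k.
Proof.
move=> k0 gk g0 gP NW.
have missing (p : glue_index) : #|p.1| < N ->
    exists i, (i \notin p.1) && ((inl i : glue) \notin W).
  move=> pN; have : ~~ (shared :\: W \subset inl @: p.1).
    apply: contraL NW => /subset_leq_card; rewrite -ltnNge => /leq_ltn_trans; apply.
    exact: leq_ltn_trans (leq_imset_card _ _) pN.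
  case/subsetPn => u; rewrite inE => /andP[uW /imsetP[i _ uE]] up.
  exists i; rewrite -uE uW andbT; apply: contra up => ip; rewrite uE.
  exact: imset_f.
pose h (p : glue_index) :=
  if [pick i | (i \notin p.1) && ((inl i : glue) \notin W)] is Some i then g i
  else fun=> 0.
pose f (u : glue) : nat := match u with inl i => 0 | inr (p, x) => h p x end.
have hE (p : glue_index) : #|p.1| < N ->
    exists2 i, (i \notin p.1) && ((inl i : glue) \notin W) & h p = g i.
  move=> pN; rewrite /h; case: pickP => [i iP|no]; first by exists i.
  by have [i] := missing p pN; rewrite no.
exists f => [u _|u v uW vW /glue_adjP[p [x [y [pN xy uE vE]]]]].
  case: u => [i|[p x]] //=; rewrite /h; case: pickP => // i _; exact: gk.
have [i /andP[ip iW] hpE] := hE p pN.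
have fi z : (place p z : glue) \in W -> f (place p z) = g i z.
  case: placeP => [j -> jp jW|_ _] /=; last by rewrite hpE.
  by rewrite g0//; apply: contraNneq iW => <-.
have nq z : (place p z : glue) \in W -> z != q i.
  case: placeP => [j -> jp jW|zq _].
    by apply: contraNneq iW => /q_inj <-.
  by apply: contraNneq ip => /zq.
by subst u v; rewrite !fi// gP// nq.
Qed.

End Glue.

(** * The Hajos chain *)

(** The vertex inl l is z_l and the vertices inr (i, _) form the i-th clique,
    of n + 1 vertices, whose element 0 is the port.  Each clique is joined to
    z_i and z_(i+1), and z_0 to z_m. *)
Section Chain.
Variables (m n : nat).
Definition chain_vertex := ('I_m.+1 + 'I_m * 'I_n.+1)%type.

Definition chain_adj (x y : chain_vertex) : bool :=
  match x, y with
  | inl l, inl l' =>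
      [&& l != l', l \in [:: ord0; ord_max] & l' \in [:: ord0; ord_max]]
  | inl l, inr (i, _) | inr (i, _), inl l =>
      (l == i :> nat) || (l == i.+1 :> nat)
  | inr (i, a), inr (j, b) => (i == j) && (a != b)
  end.

Lemma chain_adj_sym : symmetric chain_adj.
Proof.
case=> [l|[i a]] [l'|[j b]] //=; first by rewrite eq_sym; congr andb; rewrite andbC.
by rewrite eq_sym [a == b]eq_sym.
Qed.

Lemma chain_adj_irrefl : irreflexive chain_adj.
Proof. by case=> [l|[i a]] /=; rewrite !eqxx. Qed.

Definition chain : sgraph := SGraph chain_adj_sym chain_adj_irrefl.

Definition port (i : 'I_m) : chain := inr (i, ord0).

Lemma port_inj : injective port.
Proof. by move=> i j []. Qed.

Lemma port_indep i j : ~~ adj (port i) (port j).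
Proof. by rewrite /= andbF. Qed.

Lemma chain_clique : 0 < m -> exists2 K : {set chain}, is_clique K & #|K| = n.+2.
Proof.
move=> m0; pose i0 := Ordinal m0.
pose s (a : 'I_n.+1) : chain := inr (i0, a).
exists ((inl ord0 : chain) |: s @: setT); last first.
  rewrite cardsU1 card_imset ?cardsT ?card_ord => [|a b []//].
  by case: imsetP => // -[].
apply/forallP => u; apply/implyP => uK; apply/forallP => v; apply/implyP => vK.
apply/implyP => uv; move: uK vK uv; rewrite !inE.
by case/orP=> [/eqP->|/imsetP[a _ ->]]; case/orP=> [/eqP->|/imsetP[b _ ->]] //=;
  rewrite ?eqxx//; apply: contra_neq => ->.
Qed.

(** The i-th clique uses all but one of the n + 2 colours, which forces z_i and
    z_(i+1) to have the same colour; thus z_0 and z_m agree although they are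
    adjacent. *)
Lemma chain_not_colorable : 0 < m -> ~ colorable chain n.+2.
Proof.
move=> m0 /colorableP[f fk fP].
have step (i : 'I_m) (l l' : 'I_m.+1) : l = i :> nat -> l' = i.+1 :> nat ->
    f (inl l) = f (inl l').
  move=> li li'; apply/eqP/negPn/negP => ff.
  pose s := f (inl l) :: f (inl l') :: [seq f (inr (i, a)) | a <- enum 'I_n.+1].
  have fs (z : 'I_m.+1) : (z == i :> nat) || (z == i.+1 :> nat) ->
      f (inl z) \notin [seq f (inr (i, a)) | a <- enum 'I_n.+1].
    move=> zi; apply/mapP => -[a _ /eqP]; apply/negP.
    by apply: fP.
  have Us : uniq s.
    rewrite /= inE negb_or ff !fs ?li ?li' ?eqxx ?orbT//=.
    rewrite map_inj_uniq ?enum_uniq// => a b fab; apply/eqP/negPn/negP => ab.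
    have adj_ab : adj (inr (i, a) : chain) (inr (i, b)) by rewrite /= eqxx.
    by have := fP _ _ adj_ab; rewrite fab eqxx.
  have sk : {subset s <= iota 0 n.+2}.
    move=> c; rewrite mem_iota /= add0n !inE.
    by case/or3P=> [/eqP->|/eqP->|/mapP[a _ ->]]; exact: fk.
  have := uniq_leq_size Us sk.
  by rewrite /= size_map size_iota size_enum_ord ltnn.
have all0 l (lm : l < m.+1) : f (inl (Ordinal lm)) = f (inl ord0).
  elim: l lm => [|l IHl] lm; first by congr (f (inl _)); apply: val_inj.
  by rewrite -(IHl (ltnW lm)); apply/esym/(step (Ordinal (lm : l < m))).
have adj_ends : adj (inl ord_max : chain) (inl ord0).
  by rewrite /= !inE !eqxx orbT /= andbT -val_eqE /= -lt0n.
have := fP _ _ adj_ends; rewrite -(all0 m (leqnn _)).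
by rewrite (_ : ord_max = Ordinal (leqnn m.+1)) ?eqxx//; apply: val_inj.
Qed.

(** Without the port i, the i-th clique can use the colours other than 1 and 2,
    which lets z change from colour 1 to colour 2 at this position.  At the
    other positions the port has colour 0; the vertex 1 of the clique takes
    whichever of 1 and 2 is not the colour of the adjacent z, or 0 at
    position i, and the remaining vertices take the colours from 3 on. *)
Definition chain_coloring (i : 'I_m) (x : chain) : nat :=
  match x with
  | inl l => if l <= i then 1 else 2
  | inr (j, a) =>
      if a == 0 :> nat then 0
      else if a == 1 :> nat then
        if j < i then 2 else if i < j then 1 else 0
      else a.+1
  end.

Lemma chain_coloring_lt i x : 0 < n -> chain_coloring i x < n.+2.
Proof.
move=> n0; case: x => [l|[j a]] /=; first by case: ifP; lia.
by have := ltn_ord a; do 4?[case: ifP]; lia.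
Qed.

Lemma chain_coloring_proper i x y : x != port i -> y != port i ->
  adj x y -> chain_coloring i x != chain_coloring i y.
Proof.
have nport (j : 'I_m) (a : 'I_n.+1) : (inr (j, a) : chain) != port i ->
    (j != i :> nat) || (a != 0 :> nat).
  apply: contraNT; rewrite negb_or !negbK => /andP[/eqP/val_inj-> /eqP a0].
  by apply/eqP; congr (inr (_, _)); apply: val_inj.
(* Edges between some z_l and a clique. *)
have zs (l : 'I_m.+1) (j : 'I_m) (a : 'I_n.+1) : (inr (j, a) : chain) != port i ->
    (l == j :> nat) || (l == j.+1 :> nat) ->
    chain_coloring i (inl l) != chain_coloring i (inr (j, a)).
  by move=> /nport + /=; do 5?[case: ifP]; lia.
case: x => [l|[j a]]; case: y => [l'|[j' b]] xi yi.
- rewrite /= !inE => /and3P[ll' /orP l0 /orP l'0].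
  have : (l != l' :> nat) by [].
  have lm : (l == 0 :> nat) || (l == m :> nat) by case: l0 => /eqP->; rewrite eqxx ?orbT.
  have lm' : (l' == 0 :> nat) || (l' == m :> nat) by case: l'0 => /eqP->; rewrite eqxx ?orbT.
  by have := ltn_ord i; do 2?[case: ifP]; lia.
- exact: zs.
- by rewrite eq_sym; exact: zs.
- move=> /andP[/eqP jj' ab]; have /= : (a != b :> nat) by [].
  by move: (nport _ _ xi) (nport _ _ yi); rewrite -jj' /=; do 8?[case: ifP]; lia.
Qed.
End Chain.

(** * Fractional packings *)

Section FractionalBounds.
Local Open Scope ring_scope.
Variables (R : realType) (V : finType) (E : {set {set V}}).

(** Double counting of the incidences between A and the weighted edges. *)
Lemma packing_value_le (A : {set V}) (d : nat) (y : {set V} -> R) :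
    (forall F, F \in E -> (d <= #|A :&: F|)%N) -> fractional_packing E y ->
  d%:R * packing_value E y <= #|A|%:R.
Proof.
move=> dA [y0 y1].
have -> : #|A|%:R = \sum_(v in A) 1 :> R by rewrite sumr_const.
apply: (@le_trans _ _ (\sum_(v in A) \sum_(F in E | v \in F) y F)); last first.
  by apply: ler_sum => v _; exact: y1.
rewrite (exchange_big_dep (mem E))/= => [|v F _ /andP[]//].
rewrite mulr_sumr; apply: ler_sum => F FE.
rewrite (eq_bigl (mem (A :&: F))) => [|v]; last by rewrite !inE FE.
by rewrite sumr_const -[leRHS]mulr_natl ler_wpM2r ?y0// ler_nat dA.
Qed.

Lemma fractional_packing_edge (F : {set V}) : F \in E ->
  fractional_packing E (fun F' => (F' == F)%:R : R) /\
  packing_value E (fun F' => (F' == F)%:R : R) = 1.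
Proof.
move=> FE; split; last first.
  rewrite /packing_value (bigD1 F)//= eqxx big1 ?addr0// => F' /andP[_ /negbTE->//].
split=> [F' _|v]; first exact: ler0n.
rewrite big_mkcondr /= (bigD1 F)//= eqxx big1 ?addr0 => [|F' /andP[_ /negbTE->]].
  by case: ifP.
by case: ifP.
Qed.

(** Choose an edge phi v avoiding each v and give weight 1 / (n - 1) to each of
    these n choices.  A vertex u lies in phi v only for v != u, so its load is
    at most 1, while the total is n / (n - 1). *)
Lemma fractional_packing_gt1 : (1 < #|V|)%N ->
    (forall v, exists2 F, F \in E & v \notin F) ->
  exists2 y : {set V} -> R, fractional_packing E y & 1 < packing_value E y.
Proof.
move=> V1 avoid.
have [phi phiP] : exists phi : V -> {set V}, forall v, phi v \in E /\ v \notin phi v.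
  apply: (@fin_all_exists _ (fun=> {set V}) (fun v F => F \in E /\ v \notin F)) => v.
  by have [F FE vF] := avoid v; exists F.
pose w : R := (#|V|.-1)%:R^-1.
have n0 : 0 < (#|V|.-1)%:R :> R by rewrite ltr0n -ltnS prednK// ltnW.
have w0 : 0 < w by rewrite invr_gt0.
have sumE (P : pred {set V}) :
    \sum_(F in E | P F) \sum_(v | phi v == F) w = #|[pred v | P (phi v)]|%:R * w.
  rewrite mulr_natl -sumr_const.
  rewrite (partition_big phi (fun F => (F \in E) && P F)) => [|v Pv]; last first.
    by rewrite (phiP v).1.
  apply: eq_bigr => F /andP[_ PF]; apply: eq_bigl => v.
  by rewrite inE andbC; case: eqP => //= ->.
exists (fun F => \sum_(v | phi v == F) w).
  split=> [F _|u]; first by rewrite sumr_ge0// => v _; exact: ltW.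
  rewrite sumE -[leRHS](mulfV (lt0r_neq0 n0)) ler_pM2r// ler_nat.
  rewrite -(cardC1 u); apply/subset_leq_card/subsetP => v.
  by rewrite !inE; apply: contraTneq => ->; exact: (phiP u).2.
rewrite /packing_value.
have -> : \sum_(F in E) \sum_(v | phi v == F) w = #|V|%:R * w.
  by have := sumE predT; rewrite (eq_bigl (mem E)) => // F; rewrite andbT.
by rewrite -[ltLHS](mulfV (lt0r_neq0 n0)) ltr_pM2r// ltr_nat prednK// ltnW.
Qed.

End FractionalBounds.

(** * Parameters of the linked graph *)

(** H has an independent set S of N + l vertices such that N of them missing
    makes a set of vertices k-colourable, while no deletion of fewer than N
    vertices does so.  The parameters of its linked graph then follow. *)
Section Threshold.
Variables (k N M l : nat) (H : sgraph) (S : {set H}).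
Hypotheses (k2 : 2 < k) (N0 : 0 < N) (NM : N <= M) (cardS : #|S| = N + l).
Hypothesis col : forall W, N <= #|S :\: W| -> colorable_on W k.
Hypothesis ncol : forall X : {set H}, #|X| < N -> ~ colorable_on (~: X) k.

Let G := link H M.
Let core : {set G} := inl @: S.

Let inlG_inj : injective (inl : H -> G).
Proof. by move=> u v []. Qed.

Let card_core : #|core| = N + l.
Proof. by rewrite (card_imset _ inlG_inj). Qed.

Lemma bad_cycle_misses_few C : C \in bad_cycles G k -> #|core :\: cover C| < N.
Proof.
move=> /bad_cycle_not_colorable nC; rewrite ltnNge; apply/negP => NC.
apply/nC/link_colorable_on => //; apply: col; apply: leq_trans NC _.
rewrite -(card_imset _ inlG_inj).
apply/subset_leq_card/subsetP => x; rewrite inE => /andP[xC /imsetP[u uS xu]].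
by rewrite xu; apply: imset_f; rewrite !inE -xu xC.
Qed.

Lemma bad_cycle_meets_many C : C \in bad_cycles G k -> l.+1 <= #|core :&: cover C|.
Proof.
move=> /bad_cycle_misses_few misses; rewrite -(ltn_add2l N) -card_core.
by rewrite -(cardsID (cover C) core) addnC ltn_add2r.
Qed.

(** X meets fewer than N systems of connecting paths, so a system j is intact;
    the cycle through all vertices of H outside X along this system is bad by
    the robustness of H. *)
Lemma bad_cycle_avoiding (X : {set G}) : #|X| < N ->
  exists2 C, C \in bad_cycles G k & [disjoint X & cover C].
Proof.
move=> XN; have [j jX] := avoid_class
  (fun x : G => if x is inr (j, _) then Some j else None) (leq_trans XN NM).
pose XH : {set H} := inl @^-1: X.
have XHN : #|XH| < N.
  apply: leq_ltn_trans XN; rewrite -(card_imset _ inlG_inj).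
  by apply/subset_leq_card/subsetP => _ /imsetP[u + ->]; rewrite inE.
have [C [badC CH Cj _]] := link_bad_cycle j (ltnW (ltnW k2)) (ncol XHN).
exists C => //; apply/pred0Pn => -[[u|w] /andP[/= xX xC]].
  by move: xC; rewrite -[_ \in _]/((inl u : G) \in cover C) CH !inE xX.
by have /eqP := jX _ xX; apply; case: w xC {xX} => j' p /Cj <-.
Qed.

(** A bad cycle misses fewer than N vertices of S, so any N of them form a
    hitting set; a smaller set is avoided by a bad cycle. *)
Lemma tau_link : tau G k = N.
Proof.
rewrite /tau; case: arg_minnP => [|X /forallP Xhit Xmin]; first exact: hits_bad_cyclesT.
apply/eqP; rewrite eqn_leq; apply/andP; split; last first.
  rewrite leqNgt; apply/negP => /bad_cycle_avoiding[C badC XC].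
  by have /implyP/(_ badC) := Xhit C; rewrite XC.
have /card_geqP[s [Us sN sS]] : N <= #|core| by rewrite card_core leq_addr.
pose Y : {set G} := [set x in s].
have YN : #|Y| = N by rewrite cardsE (card_uniqP Us).
rewrite -YN; apply: Xmin; apply/forallP => C; apply/implyP => badC; apply/negP => YC.
have := bad_cycle_misses_few badC; rewrite ltnNge => /negP; apply.
rewrite -YN; apply/subset_leq_card/subsetP => x xY.
rewrite inE (disjointFr YC xY) /=; apply: sS.
by rewrite inE in xY.
Qed.

(** Double counting of the incidences with S: there are at least l + 1 on each
    cycle and at most c at each of the N + l vertices, and the assumption
    implies that c (N + l) < (c + 1) (l + 1). *)
Lemma nu_link_le c : c * N <= l -> nu G k c <= c.
Proof.
move=> cN; apply/bigmax_leqP => P /andP[/subsetP Pbad /forallP Pc].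
have : #|P| * l.+1 <= (N + l) * c.
  rewrite -card_core -!sum_nat_const.
  apply: (@leq_trans (\sum_(C in P) \sum_(v in core | v \in cover C) 1)).
    apply: leq_sum => C CP; rewrite (eq_bigl (mem (core :&: cover C))).
      by rewrite sum1_card; exact/bad_cycle_meets_many/Pbad.
    by move=> v; rewrite !inE.
  rewrite (exchange_big_dep (mem core))/= => [|C v _ /andP[]//].
  apply: leq_sum => v vcore; apply: leq_trans (Pc v).
  rewrite (eq_bigl (mem [set C in P | v \in cover C])) ?sum1_card// => C.
  by rewrite !inE vcore.
rewrite leqNgt => Pl; rewrite leqNgt; apply: contra Pl => cP.
by apply: (@leq_trans (c.+1 * l.+1)); [move: cN; clear; nia|rewrite leq_mul2r cP orbT].
Qed.

(** The systems j < c provide c cycles with the same trace on H. *)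
Lemma nu_link_ge c : c <= M -> c <= nu G k c.
Proof.
move=> cM; have ncolT : ~ colorable_on [set: H] k.
  by rewrite -setC0; apply: ncol; rewrite cards0.
have [C CP] := @fin_all_exists _ _ _ (fun j : 'I_M =>
  link_bad_cycle j (ltnW (ltnW k2)) ncolT).
have C_inj : injective C.
  move=> i j Cij; have [_ _ _ [w wC]] := CP i.
  have [_ _ Ci _] := CP i; have [_ _ Cj _] := CP j.
  by rewrite -(Ci _ wC) -(Cj w) // -Cij.
pose P := (C \o widen_ord cM) @: [set: 'I_c].
have cardP : #|P| = c.
  rewrite card_imset ?cardsT ?card_ord// => i j /C_inj/(congr1 val) ij.
  exact: val_inj.
rewrite -[X in X <= _]cardP; apply: leq_bigmax_cond; apply/andP; split.
  by apply/subsetP => _ /imsetP[j _ ->]; have [] := CP (widen_ord cM j).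
apply/forallP => v; rewrite -[X in _ <= X]cardP; apply/subset_leq_card/subsetP => D.
by rewrite inE => /andP[].
Qed.

Lemma nu_star_link_le (R : realType) : (l.+1%:R * nu_star R G k <= (N + l)%:R :> R)%R.
Proof.
have [y py [<- _]] := nu_star_max R G k; rewrite -card_core.
apply: packing_value_le py => _ /imsetP[C badC ->].
exact: bad_cycle_meets_many.
Qed.

Lemma nu_star_link_ge1 (R : realType) : (1 <= nu_star R G k :> R)%R.
Proof.
have [C badC _] : exists2 C, C \in bad_cycles G k & [disjoint set0 & cover C].
  by apply: bad_cycle_avoiding; rewrite cards0.
have [y _ [<- ymax]] := nu_star_max R G k.
have [pF <-] := fractional_packing_edge R (imset_f (@cover G) badC).
exact: ymax.
Qed.

Lemma nu_star_link_gt1 (R : realType) : 1 < N -> 1 < #|G| ->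
  (1 < nu_star R G k :> R)%R.
Proof.
move=> N1 G1; have [y _ [<- ymax]] := nu_star_max R G k.
have [|z pz z1] := @fractional_packing_gt1 R G (bad_hypergraph G k) G1.
  move=> v; have [|C badC vC] := @bad_cycle_avoiding [set v].
    by rewrite cards1.
  by exists (cover C); [exact: imset_f|rewrite -disjoints1].
exact: lt_le_trans z1 (ymax z pz).
Qed.

Hypothesis Sind : {in S &, forall u v, ~~ adj u v}.

(** H without S is k-colourable, and the independent set S takes one further
    colour. *)
Lemma chromatic_number_link : chromatic_number G = k.+1.
Proof.
apply/eqP; rewrite eqn_leq chromatic_number_le ltnNge chromatic_number_le.
apply/andP; split.
  apply/colorable_setT/link_colorable_on; first exact: ltnW.
  apply: (@colorable_onS _ _ (~: S :|: S)); first by rewrite setUC setUCr subsetT.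
  apply: colorable_onU_indep Sind; apply: col.
  by rewrite setDE setCK setIid cardS leq_addr.
apply/negP => /colorable_setT/colorable_on_inl colT.
apply: (ncol (X := set0)); first by rewrite cards0.
by apply: colorable_onS colT; apply/subsetP => u; rewrite !inE.
Qed.

(** A clique has at most one vertex in S, so it misses at least N of them and is
    k-colourable. *)
Lemma clique_number_link (K : {set H}) : 0 < l -> is_clique K -> #|K| = k ->
  clique_number G = k.
Proof.
move=> l0 /forallP cK cardK; apply/eqP; rewrite eqn_leq; apply/andP; split.
  apply/bigmax_leqP => K' cK'; apply: clique_colorable_on (cK') _.
  apply: link_colorable_on => //; apply: col.
  set W := _ @^-1: K'.
  have : #|S :&: W| <= 1.
    rewrite leqNgt; apply/negP => /card_gt1P[u [v [uSW vSW uv]]].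
    move: uSW vSW; rewrite !inE => /andP[uS uK] /andP[vS vK].
    have /forallP/(_ (inl u))/implyP/(_ uK)/forallP/(_ (inl v))/implyP/(_ vK) := cK'.
    by move=> /implyP/(_ uv); rewrite /= (negbTE (Sind uS vS)).
  move=> SW; rewrite -(leq_add2l l) addnC -cardS -(cardsID W S) leq_add2r.
  exact: leq_trans SW l0.
rewrite -cardK -(card_imset K inlG_inj); apply: leq_bigmax_cond.
apply/forallP => x; apply/implyP => /imsetP[u uK ->].
apply/forallP => y; apply/implyP => /imsetP[v vK ->].
apply/implyP => uv; have /implyP/(_ uK)/forallP/(_ v)/implyP/(_ vK)/implyP := cK u.
by apply; apply: contra_neq uv => ->.
Qed.

End Threshold.

(** * The theorem *)

Local Open Scope ring_scope.

Theorem theorem4p2 (R : realType) (k : nat) (hk : (3 <= k)%N) (b N : nat)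
    (hb : (1 <= b)%N) (hN : (1 <= N)%N) (eps : R) (heps : 0 < eps) :
  exists G : sgraph,
    k_connected 2 G /\
    chromatic_number G = k.+1 /\
    clique_number G = k /\
    (#|edges G| <= k * #|G|)%N /\
    tau G k = N /\
    (forall c : nat, (1 <= c <= b)%N -> nu G k c = c) /\
    ((2 <= N)%N -> 1 < nu_star R G k /\ nu_star R G k < 1 + eps) /\
    (N = 1%N -> nu_star R G k = 1).
Proof.
have [n kE n0] : exists2 n, k = n.+2 & (0 < n)%N.
  by exists k.-2; lia.
(* The first term serves the packings with c <= b, the second the bound on
   nu_star. *)
pose l := (b * N + Num.bound (N%:R / eps))%N.
have bNl : (b * N <= l)%N by rewrite leq_addr.
have Nl : N%:R < l.+1%:R * eps.
  rewrite -ltr_pdivrMr//; apply: lt_le_trans (archi_boundP _) _.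
    by rewrite divr_ge0// ltW.
  by rewrite ler_nat leqW// leq_addl.
have m0 : (0 < N + l)%N by lia.
(* M >= N for robustness, M >= b for c <= b distinct cycles on one trace, and
   M >= 2 for 2-connectedness. *)
pose M := (N + b).+1.
pose L := chain (N + l) n; pose q := @port (N + l) n.
pose H := glue N q; pose S := shared N q.
have q_inj : injective q by exact: port_inj.
have cardS : #|S| = (N + l)%N by exact: card_shared.
have col (W : {set H}) : (N <= #|S :\: W|)%N -> colorable_on W k.
  rewrite kE; apply: (@glue_colorable L _ N q q_inj _ W (@chain_coloring _ n)) => //.
  - by move=> i x; exact: chain_coloring_lt.
  - exact: chain_coloring_proper.
have ncol (X : {set H}) : (#|X| < N)%N -> ~ colorable_on (~: X) k.
  by apply: glue_not_colorable => //; rewrite kE; exact: chain_not_colorable.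
have Sind : {in S &, forall u v, ~~ adj u v}.
  by apply: shared_indep; exact: port_indep.
have [K cK cardK] : exists2 K : {set H}, is_clique K & #|K| = k.
  have [K0 cK0 cardK0] := chain_clique n m0; rewrite kE -cardK0.
  exact: glue_clique.
have H2 : (2 < #|H|)%N.
  by apply: leq_trans hk _; rewrite -cardK max_card.
have G1 : (1 < #|link H M|)%N by rewrite card_sum; lia.
have NM : (N <= M)%N by lia.
exists (link H M); split; first by apply: link_2connected => //; lia.
split; first exact (chromatic_number_link M hk hN cardS col ncol Sind).
have l0 : (0 < l)%N by nia.
split; first exact (clique_number_link M hk cardS col Sind l0 cK cardK).
split; first by rewrite (leq_trans (@card_edges_link H M isT))// leq_mul2r hk orbT.
split; first exact (tau_link hk NM cardS col ncol).
split.
  move=> c /andP[c1 cb]; apply/eqP; rewrite eqn_leq.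
  rewrite (nu_link_le _ hk cardS col)/=; last by nia.
  by apply: nu_link_ge hk hN ncol _ _; lia.
have nule := nu_star_link_le M hk cardS col R.
split=> [N2|N1].
  split; first exact (nu_star_link_gt1 hk NM ncol R N2 G1).
  have lR0 : 0 < l.+1%:R :> R by rewrite ltr0n.
  rewrite -(ltr_pM2l lR0); apply: le_lt_trans nule _.
  rewrite mulrDr mulr1 natrD addrC -natr1 -addrA ltrD2l natr1.
  by apply: lt_le_trans Nl _; rewrite lerDr ler01.
apply/eqP; rewrite eq_le (nu_star_link_ge1 hk hN NM ncol) andbT.
have Nl1 : (N + l)%:R = l.+1%:R :> R by congr _%:R; lia.
by move: nule; rewrite Nl1 ger_pMr ?ltr0n.
Qed.
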